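(* There is an absolute constant $K>0$ such that the following holds. Let $n,p,k,b$ be positive integers with $2\le p\le n$ and $1\le k\le n/b$. (i) For every $\gamma\in(0,1)$ with $\left|\gamma-\tfrac12\right|\le \frac{1}{4\log p}$, $$\mathcal{E}\bigl(B_\gamma^{(p)},C_\gamma^{(p)}\bigr)\le K\left(\sqrt{k}\log p+\sqrt{\tfrac{nk}{b}}+\sqrt{\tfrac{nk\log p}{p}}+\sqrt{\tfrac{kp\log p}{b}}\right).$$ (ii) If additionally $p\le \sqrt{n}/4$, then for $\gamma=1-\frac{p}{\sqrt n}$, $$\mathcal{E}\bigl(B_\gamma^{(p)},C_\gamma^{(p)}\bigr)\le K\left(\sqrt{k}\,n^{1/4}+\sqrt{\tfrac{nk}{b}}\right).$$
   Context: $\log$ denotes the natural logarithm. $E\in\mathbb{R}^{n\times n}$ is the prefix-sum matrix: $E_{ij}=1$ if $i\ge j$ and $0$ otherwise. For $0<\gamma<1$ let $(\tilde c_\gamma)_i:=(-1)^i\binom{\gamma}{i}$, where $\binom{\gamma}{i}=\prod_{j=1}^{i}\frac{\gamma+1-j}{j}$ (so $(\tilde c_\gamma)_0=1$); equivalently $(1-x)^\gamma=\sum_{i\ge0}(\tilde c_\gamma)_i x^i$ for $|x|<1$. For an integer bandwidth $p\ge1$, $(C_\gamma^{(p)})^{-1}$ is the $n\times n$ lower-triangular Toeplitz matrix whose $r$-th subdiagonal ($r=0$ being the main diagonal) has all entries equal to $(\tilde c_\gamma)_r$ for $0\le r\le p-1$ and equal to $0$ for $r\ge p$; $C_\gamma^{(p)}$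 is its inverse (the ''$\gamma$-BIFR strategy matrix''), and $B_\gamma^{(p)}:=E\,(C_\gamma^{(p)})^{-1}$, so $B_\gamma^{(p)}C_\gamma^{(p)}=E$. For an $n\times n$ matrix $C$ and integers $k,b\ge1$ with $(k-1)b\le n-1$, define $\mathrm{sens}_{k,b}(C):=\bigl\|\sum_{j=0}^{k-1}C_{[\cdot,jb]}\bigr\|_2$, where $C_{[\cdot,m]}$ denotes the $m$-th column of $C$ with columns indexed from $0$ (for lower-triangular Toeplitz $C$ with nonnegative nonincreasing diagonals this is the $\ell_2$-sensitivity under $b$-min-separated participation with at most $k$ participations). The RMSE of a factorization $E=BC$ is $\mathcal{E}(B,C):=\|B\|_F\cdot \mathrm{sens}_{k,b}(C)/\sqrt n$. *)

(* Defs.v *)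
From HB Require Import structures.
From mathcomp Require Import all_boot all_order all_algebra.
From mathcomp Require Import reals exp Rstruct.
From Stdlib Require Rdefinitions.
Set Implicit Arguments. Unset Strict Implicit. Unset Printing Implicit Defensive.
Import Order.TTheory GRing.Theory Num.Theory.
Local Open Scope ring_scope.

Notation RR := Rdefinitions.R.

Definition gbinom (g : RR) (i : nat) : RR :=
  \prod_(1 <= j < i.+1) ((g + 1 - j%:R) / j%:R).
Definition ctil (g : RR) (i : nat) : RR := (-1) ^+ i * gbinom g i.

Definition Emat (n : nat) : 'M[RR]_n := \matrix_(i < n, j < n) (if (j <= i)%N then 1 else 0).

Definition Cinv (n p : nat) (g : RR) : 'M[RR]_n :=
  \matrix_(i < n, j < n) (if (j <= i)%N && (i - j < p)%N then ctil g (i - j) else 0).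

Definition Cmat (n p : nat) (g : RR) : 'M[RR]_n := invmx (Cinv n p g).
Definition Bmat (n p : nat) (g : RR) : 'M[RR]_n := Emat n *m Cinv n p g.

Definition frob (n : nat) (A : 'M[RR]_n) : RR :=
  Num.sqrt (\sum_(i < n) \sum_(j < n) A i j ^+ 2).

(* entry (i, m) of C with column index m given as a natural number (0 if m >= n) *)
Definition entry (n : nat) (C : 'M[RR]_n) (i : 'I_n) (m : nat) : RR :=
  if insub m is Some j then C i j else 0.

Definition sens (n k b : nat) (C : 'M[RR]_n) : RR :=
  Num.sqrt (\sum_(i < n) (\sum_(j < k) entry C i (j * b)) ^+ 2).

Definition rmse (n k b : nat) (B C : 'M[RR]_n) : RR :=
  frob B * sens k b C / Num.sqrt n%:R.

Notation "n %:RR" := (n%:R : RR) (at level 2, left associativity, format "n %:RR").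

(* Main.v *)
(** With dl = 1 - gamma, the Toeplitz matrix B has diagonals
    t_m = s_(min m (p-1)), where s_m = dl * v_m / (m + dl) are the coefficients
    of (1 - x)^(- dl) and v_m = s_0 + ... + s_m those of (1 - x)^(- 1 - dl).
    The sequence t is positive and log-convex, so by Kaluza's theorem 1/t(x) has
    nonpositive coefficients beyond the constant one.  Hence the diagonals d_m
    of C, whose generating series is 1/((1 - x) t(x)), are nonincreasing; they
    are nonnegative and satisfy sum_(i <= m) t_(m-i) d_i = 1.  This gives
    d_m <= 1/v_m for m < p and sum_m d_m <= 1/s_(p-1), and monotonicity turns
    the cross terms of the sensitivity into (2/b) (sum_m d_m)^2 per
    participation.  It remains to insert (m+1)^dl <= v_m <= 2 m^dl. *)

Require Import Defs.
From HB Require Import structures.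
From mathcomp Require Import all_boot all_order all_algebra.
From mathcomp Require Import reals exp Rstruct.
From mathcomp Require Import ring lra zify.
Import Order.TTheory GRing.Theory Num.Theory.
Local Open Scope ring_scope.

(** * Power series by coefficients: Cauchy product, reciprocal, partial sums *)

Section Convolution.
Variable R : realFieldType.
Implicit Types f g e : nat -> R.

Definition conv f g (m : nat) : R := \sum_(i < m.+1) f (m - i)%N * g i.

Lemma convC f g m : conv f g m = conv g f m.
Proof.
rewrite /conv (reindex_inj rev_ord_inj) /=; apply: eq_bigr => i _.
have im : (i <= m)%N by rewrite -ltnS.
by rewrite subSS subKn // mulrC.
Qed.

Lemma convSr f g m : conv f g m.+1 = (\sum_(i < m.+1) f (m.+1 - i)%N * g i) + f 0%N * g m.+1.
Proof. by rewrite /conv big_ord_recr /= subnn. Qed.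

(** Coefficients of 1/f(x) when [f 0 = 1]. Each depends on all earlier ones, so the recursion builds
    the list of the first [n] and stays structural. *)
Fixpoint recip_seq f n : seq R :=
  if n is n'.+1 then
    let s := recip_seq f n' in
    rcons s ((n' == 0%N)%:R - \sum_(i < n') f (n' - i)%N * s`_i)
  else [::].

Definition recip f m : R := (recip_seq f m.+1)`_m.

Lemma size_recip_seq f n : size (recip_seq f n) = n.
Proof. by elim: n => //= n IH; rewrite size_rcons IH. Qed.

Lemma nth_recip_seq f n m : (m < n)%N -> (recip_seq f n)`_m = recip f m.
Proof.
elim: n => // n IH; rewrite ltnS leq_eqVlt => /orP[/eqP -> //|mn].
by rewrite -IH //= nth_rcons size_recip_seq mn.
Qed.

Lemma conv_recip f m : f 0%N = 1 -> conv f (recip f) m = (m == 0%N)%:R.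
Proof.
move=> f0; rewrite /conv big_ord_recr /= subnn f0 mul1r.
rewrite {2}/recip /= nth_rcons size_recip_seq ltnn eqxx.
under [X in _ - X]eq_bigr => i _ do rewrite nth_recip_seq //.
by rewrite addrC subrK.
Qed.

(* Kaluza's theorem *)
Lemma recip_le0 f m : f 0%N = 1 -> (forall i, 0 < f i) ->
    (forall i l, (i <= l)%N -> f i.+1 * f l <= f l.+1 * f i) ->
  recip f m.+1 <= 0.
Proof.
move=> f0 fpos fconvex; elim/ltn_ind: m => m IH.
have := conv_recip f m.+1 f0; rewrite convSr f0 mul1r /= => /eqP.
rewrite addrC addr_eq0 => /eqP e_rec.
suff: f m * recip f m.+1 <= 0 by rewrite pmulr_rle0.
rewrite e_rec mulrN oppr_le0.
(* The sum is compared with [f m.+1] times the recurrence at [m], which is nonnegative. The terms of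
   index 0 agree; in each later difference log-convexity and the induction hypothesis supply two
   nonpositive factors. *)
apply: (@le_trans _ _ (f m.+1 * conv f (recip f) m)).
  by rewrite conv_recip // mulr_ge0 ?ler0n ?ltW.
rewrite /conv !mulr_sumr; apply: ler_sum => -[[|i] /= im] _.
  by rewrite !subn0 mulrCA.
rewrite subSS !mulrA -subr_ge0 -mulrBl mulr_le0 //; last exact: IH.
rewrite subr_le0 [f m * _]mulrC.
have -> : (m - i = (m - i.+1).+1)%N by lia.
by apply: fconvex; lia.
Qed.

Definition psum f m : R := \sum_(i < m.+1) f i.

Lemma psumS f m : psum f m.+1 = psum f m + f m.+1.
Proof. by rewrite /psum big_ord_recr. Qed.

Lemma psum0 f : psum f 0 = f 0%N.
Proof. by rewrite /psum big_ord_recr big_ord0 /= add0r. Qed.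

Lemma conv1_psum f m : conv (fun=> 1) f m = psum f m.
Proof. by apply: eq_bigr => i _; rewrite mul1r. Qed.

(** Dividing g(x) by 1 - x divides f(x) g(x) by 1 - x, so successive coefficients of the new product
    differ by those of the old one. *)
Lemma conv_psum f g m : conv f (psum g) m.+1 = conv f (psum g) m + conv f g m.+1.
Proof.
rewrite !(convC f) !convSr psum0 addrA /conv -big_split /=; congr (_ + _).
apply: eq_bigr => i _; rewrite subSn; last by rewrite -ltnS.
by rewrite psumS mulrDl.
Qed.

(** The renewal identity f(x) d(x) = 1/(1 - x), which yields nonnegativity and the size bounds for
    the diagonals of C. *)
Lemma conv_psum_recip f m : f 0%N = 1 -> conv f (psum (recip f)) m = 1.
Proof.
move=> f0; elim: m => [|m IH]; last by rewrite conv_psum IH conv_recip // addr0.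
by rewrite /conv big_ord1 psum0 /= subn0 -[RHS](conv_recip f 0 f0) /conv big_ord1.
Qed.

Lemma conv_psuml f g m : conv (psum f) g m.+1 = conv (psum f) g m + conv f g m.+1.
Proof. by rewrite convC conv_psum !(convC g). Qed.

End Convolution.

Arguments psum {R} f m.
Arguments conv {R} f g m.
Arguments recip {R} f m.

(** * Lower triangular Toeplitz matrices as truncated power series *)

Section Toeplitz.
Variable R : realFieldType.
Implicit Types f g : nat -> R.

Definition toep n f : 'M[R]_n :=
  \matrix_(i < n, j < n) (if (j <= i)%N then f (i - j)%N else 0).

Lemma mul_toep n f g : toep n f *m toep n g = toep n (conv f g).
Proof.
apply/matrixP => i j; rewrite !mxE.
under eq_bigr => l _ do rewrite !mxE.
case: leqP => [ji|ij]; last first.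
  rewrite big1 // => l _; case: leqP => li; last by rewrite mul0r.
  by rewrite leqNgt (leq_ltn_trans li ij) mulr0.
pose F l := (if (l <= i)%N then f (i - l)%N else 0) *
            (if (j <= l)%N then g (l - j)%N else 0).
rewrite (eq_bigr (fun l : 'I_n => F l)) //.
(* Outside j <= l <= i one factor vanishes; shifting the remaining range by [j] gives the
   convolution at [i - j]. *)
rewrite -(big_mkord xpredT F) (@big_cat_nat _ _ _ j) //=; last exact: ltnW.
rewrite big_nat_cond big1 ?add0r; last first.
  by move=> l /andP[/andP[_ lj] _]; rewrite /F [(j <= l)%N]leqNgt lj mulr0.
rewrite (@big_cat_nat _ _ _ i.+1) //=; last by rewrite (leq_trans ji).
rewrite [X in _ + X]big_nat_cond [X in _ + X]big1 ?addr0; last first.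
  by move=> l /andP[/andP[il _] _]; rewrite /F leqNgt il mul0r.
rewrite -{1}[nat_of_ord j]add0n big_addn subSn // big_mkord /conv.
apply: eq_bigr => l _; rewrite /F leq_addl addnK.
have -> : (l + j <= i)%N by have := ltn_ord l; lia.
by congr (f _ * _); lia.
Qed.

Lemma toep_delta n f : (forall m, f m = (m == 0%N)%:R) -> toep n f = 1%:M.
Proof.
move=> f_delta; apply/matrixP => i j; rewrite !mxE f_delta -val_eqE /=.
by case: leqP => ij; [rewrite subn_eq0 eqn_leq ij andbT | rewrite ltn_eqF].
Qed.

Lemma invmx_toep n f g : (forall m, conv f g m = (m == 0%N)%:R) ->
  invmx (toep n f) = toep n g.
Proof.
move=> fg; have fg1 : toep n f *m toep n g = 1%:M.
  by rewrite mul_toep toep_delta.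
have [f_unit _] := mulmx1_unit fg1.
by rewrite -[LHS]mulmx1 -fg1 mulKmx.
Qed.

End Toeplitz.

Arguments toep {R} n f.

(** * Sums of nonnegative sequences and the sensitivity *)

Section NonnegSums.
Variable R : realFieldType.
Implicit Types (h d x : nat -> R).

Lemma sum_ord_const (a : R) (n : nat) : \sum_(i < n) a = n%:R * a.
Proof. by rewrite sumr_const card_ord mulr_natl. Qed.

Lemma ler_sum_prefix h (m n : nat) : (forall i, 0 <= h i) -> (m <= n)%N ->
  \sum_(i < m) h i <= \sum_(i < n) h i.
Proof.
move=> h0 /subnKC <-; rewrite big_split_ord /= lerDl; exact: sumr_ge0.
Qed.

Lemma sum_shift_le h (a n : nat) : (forall i, 0 <= h i) ->
  \sum_(i < n) (if (a <= i)%N then h (i - a)%N else 0) <= \sum_(i < n) h i.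
Proof.
move=> h0; apply: (@le_trans _ _ (\sum_(i < n - a) h i)); last first.
  by apply: ler_sum_prefix => //; lia.
rewrite le_eqVlt; apply/orP; left; apply/eqP; elim: n => [|n IH].
  by rewrite sub0n !big_ord0.
rewrite big_ord_recr /= IH; case: leqP => an; first by rewrite subSn // big_ord_recr.
have -> : (n.+1 - a = 0)%N by lia.
have -> : (n - a = 0)%N by lia.
by rewrite !big_ord0 addr0.
Qed.

(** Cross terms are grouped under their larger index, so that each participation is paired only with
    earlier ones. *)
Lemma sqr_sum x (k : nat) : (\sum_(j < k) x j) ^+ 2 =
  \sum_(j < k) (x j ^+ 2 + 2 * x j * \sum_(l < j) x l).
Proof.
elim: k => [|k IH]; first by rewrite !big_ord0 expr0n.
by rewrite big_ord_recr /= sqrrD IH [RHS]big_ord_recr /=; ring.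
Qed.

(** Each sampled value is at most every one of the [b] values in the block just before it. *)
Lemma sum_multiples_le d (b L : nat) : (forall i j, (i <= j)%N -> d j <= d i) ->
  b%:R * \sum_(l < L) d (l.+1 * b)%N <= \sum_(t < L * b) d t.
Proof.
move=> d_dec; elim: L => [|L IH]; first by rewrite big_ord0 mul0n big_ord0 mulr0.
rewrite big_ord_recr /= mulrDr mulSnr big_split_ord /= lerD //.
rewrite -sum_ord_const; apply: ler_sum => u _.
by apply: d_dec; rewrite leq_add2l ltnW.
Qed.

(** Squares contribute one shifted copy of the sum of d^2 per participation. In the cross terms the
    earlier participations sum to at most 1/(bc), and the remaining factor sums over the rows to at
    most 1/c. *)
Lemma sens_sum_le d (c : R) (n k b : nat) :
    (forall i, 0 <= d i) -> (forall i j, (i <= j)%N -> d j <= d i) ->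
    0 < c -> (forall N : nat, c * \sum_(i < N) d i <= 1) -> (0 < b)%N ->
  \sum_(i < n) (\sum_(j < k) (if (j * b <= i)%N then d (i - j * b)%N else 0)) ^+ 2
    <= k%:R * (\sum_(t < n) d t ^+ 2 + 2 * (b%:R * c ^+ 2)^-1).
Proof.
move=> d0 d_dec c0 d_sum b0; have b0R : 0 < b%:R :> R by rewrite ltr0n.
have d_sum' N : \sum_(i < N) d i <= c^-1 by rewrite -[c^-1]mul1r ler_pdivlMr // mulrC.
pose X (i j : nat) := if (j * b <= i)%N then d (i - j * b)%N else 0.
have X0 i j : 0 <= X i j by rewrite /X; case: ifP.
(* In a row reached by participation [j], the earlier ones have lags at least b, 2b, ..., jb, so
   monotonicity reduces them to multiples of [b]. *)
have tail_le (i j : nat) : X i j * \sum_(l < j) X i l <= X i j * (b%:R * c)^-1.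
  rewrite {1 3}/X; case: leqP => [jbi|_]; last by rewrite !mul0r.
  apply: ler_wpM2l => //; apply: (@le_trans _ _ (\sum_(l < j) d (l.+1 * b)%N)).
    rewrite [X in _ <= X](reindex_inj rev_ord_inj); apply: ler_sum => l _ /=.
    have lj := ltn_ord l.
    have lb : (l * b <= j * b)%N by rewrite leq_mul2r ltnW ?orbT.
    rewrite /X (leq_trans lb jbi); apply: d_dec.
    have -> : ((j - l.+1).+1 = j - l)%N by lia.
    by rewrite mulnBl leq_sub2r.
  rewrite invfM mulrC ler_pdivlMr // mulrC.
  by apply: le_trans (sum_multiples_le _ _ _ d_dec) (d_sum' _).
apply: (@le_trans _ _ (\sum_(i < n) \sum_(j < k)
    (X i j ^+ 2 + 2 * (b%:R * c)^-1 * X i j))).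
  apply: ler_sum => i _; rewrite (sqr_sum (X i)); apply: ler_sum => j _.
  rewrite lerD2l -!mulrA ler_pM2l // [leRHS]mulrC; exact: tail_le.
rewrite exchange_big /= -[leRHS]sum_ord_const.
apply: ler_sum => j _; rewrite big_split /= lerD //.
  rewrite (eq_bigr (fun i : 'I_n =>
      if (j * b <= i)%N then d (i - j * b)%N ^+ 2 else 0)); last first.
    by move=> i _; rewrite /X; case: ifP => // _; rewrite expr0n.
  by apply: (sum_shift_le (fun i => d i ^+ 2)) => i; rewrite exprn_ge0.
rewrite -mulr_sumr -mulrA ler_pM2l // expr2 mulrA [leRHS]invfM.
apply: ler_wpM2l; first by rewrite invr_ge0 mulr_ge0 ?ltW.
exact: le_trans (sum_shift_le d _ _ d0) (d_sum' _).
Qed.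

(** Below [p] each term is bounded pointwise; beyond it one factor is at most 1/V and the other sums
    to at most 1/c. *)
Lemma sum_sqr_le d (w : nat -> R) (c V : R) (n p : nat) : (p <= n)%N ->
    (forall i, 0 <= d i) -> 0 < c -> (forall N : nat, c * \sum_(i < N) d i <= 1) ->
    (forall i, 0 < w i) -> (forall i, (i < p)%N -> d i * w i <= 1) ->
    0 < V -> (forall i, (p <= i)%N -> d i * V <= 1) ->
  \sum_(t < n) d t ^+ 2 <= \sum_(t < p) (w t ^+ 2)^-1 + (V * c)^-1.
Proof.
move=> /subnKC <- d0 c0 d_sum w0 dw V0 dV; rewrite big_split_ord /= lerD //.
  apply: ler_sum => t _; rewrite -exprVn ler_pXn2r ?nnegrE ?invr_ge0 ?(ltW (w0 _)) //.
  by rewrite -[leRHS]mul1r ler_pdivlMr // dw.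
apply: (@le_trans _ _ (V^-1 * \sum_(t < n - p) d (p + t)%N)).
  rewrite mulr_sumr; apply: ler_sum => t _; rewrite expr2 ler_wpM2r //.
  by rewrite -[leRHS]mul1r ler_pdivlMr // dV // leq_addr.
rewrite invfM ler_wpM2l ?invr_ge0 ?(ltW V0) //.
apply: (@le_trans _ _ (\sum_(t < p + (n - p)) d t)).
  by rewrite big_split_ord /= lerDr sumr_ge0.
by rewrite -[leRHS]mul1r ler_pdivlMr // mulrC.
Qed.

Lemma toep_frob_le n (f : nat -> R) : \sum_(i < n) \sum_(j < n) toep n f i j ^+ 2
  <= n%:R * \sum_(t < n) f t ^+ 2.
Proof.
rewrite exchange_big /= -[leRHS]sum_ord_const.
apply: ler_sum => j _; rewrite (eq_bigr (fun i : 'I_n =>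
    if (j <= i)%N then f (i - j)%N ^+ 2 else 0)); last first.
  by move=> i _; rewrite mxE; case: ifP => // _; rewrite expr0n.
by apply: (sum_shift_le (fun i => f i ^+ 2)) => i; rewrite sqr_ge0.
Qed.

End NonnegSums.

(** * Bounds for the coefficients of 1/((1 - x) f(x)) *)

Section Renewal.
Variable (R : realFieldType) (f : nat -> R).
Hypotheses (f0 : f 0%N = 1) (f_gt0 : forall i, 0 < f i)
  (f_dec : forall i, f i.+1 <= f i)
  (f_convex : forall i l, (i <= l)%N -> f i.+1 * f l <= f l.+1 * f i).
Let d := psum (recip f).

Lemma psum_recip_dec i j : (i <= j)%N -> d j <= d i.
Proof.
move=> /subnKC <-; elim: (j - i)%N => [|k IH]; first by rewrite addn0.
by rewrite addnS /d psumS (le_trans _ IH) // gerDl recip_le0.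
Qed.

(** Subtracting the renewal identities at m and m + 1 writes d_(m+1) as the sum of (f_(m-i) -
    f_(m+1-i)) d_i, nonnegative by induction as [f] decreases. *)
Lemma psum_recip_ge0 i : 0 <= d i.
Proof.
elim/ltn_ind: i => -[|m] IH.
  by have := conv_psum_recip R f 0 f0; rewrite /conv big_ord1 f0 mul1r /d => ->.
have := conv_psum_recip R f m.+1 f0; rewrite -(conv_psum_recip R f m f0).
rewrite convSr f0 mul1r addrC => /eqP; rewrite eq_sym -subr_eq /d => /eqP <-.
rewrite /conv -sumrB sumr_ge0 // => i _; rewrite -mulrBl mulr_ge0 ?IH //.
by rewrite subr_ge0 subSn // -ltnS.
Qed.

(** In the renewal identity at [m], every d_(m-i) is at least d_m. *)
Lemma psum_recip_mul_le1 m : d m * psum f m <= 1.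
Proof.
rewrite -(conv_psum_recip R f m f0) convC /conv /psum mulr_sumr.
apply: ler_sum => i _; rewrite ler_wpM2r ?(ltW (f_gt0 _)) //.
by apply: psum_recip_dec; rewrite leq_subr.
Qed.

Lemma sum_psum_recip_le1 (c : R) : (forall i, c <= f i) ->
  forall N : nat, c * \sum_(i < N) d i <= 1.
Proof.
move=> cf [|m]; first by rewrite big_ord0 mulr0 ler01.
rewrite -(conv_psum_recip R f m f0) /conv mulr_sumr.
by apply: ler_sum => i _; rewrite ler_wpM2r // psum_recip_ge0.
Qed.

End Renewal.

(** * Coefficients of (1 - x)^(-dl) and (1 - x)^(-1-dl) *)

Section BinomialSequences.
Variable (R : realFieldType) (dl : R).
Hypotheses (dl_gt0 : 0 < dl) (dl_lt1 : dl < 1).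

Definition sseq (m : nat) : R := \prod_(1 <= j < m.+1) (1 - (1 - dl) / j%:R).
Definition vseq (m : nat) : R := \prod_(1 <= j < m.+1) (1 + dl / j%:R).

Lemma sseq0 : sseq 0 = 1. Proof. by rewrite /sseq big_geq. Qed.
Lemma vseq0 : vseq 0 = 1. Proof. by rewrite /vseq big_geq. Qed.

Lemma sseqS m : sseq m.+1 = sseq m * (1 - (1 - dl) / m.+1%:R).
Proof. by rewrite /sseq big_nat_recr. Qed.

Lemma vseqS m : vseq m.+1 = vseq m * (1 + dl / m.+1%:R).
Proof. by rewrite /vseq big_nat_recr. Qed.

Lemma vseq_gt0 m : 0 < vseq m.
Proof.
elim: m => [|m IH]; first by rewrite vseq0 ltr01.
by rewrite vseqS mulr_gt0 // addr_gt0 // divr_gt0.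
Qed.

(** Passing from the rising factorial of dl to that of 1 + dl trades the factor dl for m + dl. *)
Lemma sseqE m : sseq m = dl * vseq m / (m%:R + dl).
Proof.
elim: m => [|m IH]; first by rewrite sseq0 vseq0 add0r mulr1 divff ?gt_eqF.
have m0 : 0 <= m%:R :> R by rewrite ler0n.
rewrite sseqS vseqS IH -natr1; field.
by have dl0 := dl_gt0; apply/and3P; split; lra.
Qed.

Lemma sseq_gt0 m : 0 < sseq m.
Proof. by rewrite sseqE divr_gt0 ?mulr_gt0 ?vseq_gt0 // ltr_wpDl. Qed.

Lemma sseq_dec i j : (i <= j)%N -> sseq j <= sseq i.
Proof.
move=> /subnKC <-; elim: (j - i)%N => [|k IH]; first by rewrite addn0.
rewrite addnS sseqS (le_trans _ IH) // ler_piMr ?(ltW (sseq_gt0 _)) //.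
by rewrite gerBl divr_ge0 // subr_ge0 ltW.
Qed.

Lemma psum_sseq m : psum sseq m = vseq m.
Proof.
elim: m => [|m IH]; first by rewrite psum0 sseq0 vseq0.
have m0 : 0 <= m%:R :> R by rewrite ler0n.
rewrite psumS IH sseqE vseqS -natr1; field.
by have dl0 := dl_gt0; apply/andP; split; lra.
Qed.

(* [q] stands for the bandwidth minus one. *)
Definition tseq (q m : nat) : R := sseq (minn m q).

Lemma tseq0 q : tseq q 0 = 1.
Proof. by rewrite /tseq min0n sseq0. Qed.

Lemma tseq_gt0 q m : 0 < tseq q m. Proof. exact: sseq_gt0. Qed.

Lemma tseq_dec q m : tseq q m.+1 <= tseq q m.
Proof. by apply: sseq_dec; lia. Qed.

Lemma tseq_ge q m : sseq q <= tseq q m.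
Proof. by apply: sseq_dec; lia. Qed.

(** The ratio of consecutive terms is 1 - (1 - dl)/(m + 1) before [q], which increases with m, and 1
    from [q] on; hence it never decreases. *)
Lemma tseq_convex q i l : (i <= l)%N ->
  tseq q i.+1 * tseq q l <= tseq q l.+1 * tseq q i.
Proof.
move=> il; case: (leqP q l) => ql.
  have El : tseq q l.+1 = tseq q l by rewrite /tseq; congr sseq; lia.
  by rewrite El mulrC ler_pM2l ?tseq_gt0 // tseq_dec.
have -> : tseq q i.+1 = sseq i.+1 by rewrite /tseq; congr sseq; lia.
have -> : tseq q l.+1 = sseq l.+1 by rewrite /tseq; congr sseq; lia.
have -> : tseq q i = sseq i by rewrite /tseq; congr sseq; lia.
have -> : tseq q l = sseq l by rewrite /tseq; congr sseq; lia.
rewrite !sseqS mulrAC [leRHS]mulrAC [sseq l * _]mulrC.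
rewrite ler_pM2l ?mulr_gt0 ?sseq_gt0 // lerD2l lerN2.
rewrite ler_wpM2l ?subr_ge0 ?(ltW dl_lt1) //.
by rewrite lef_pV2 ?posrE ?ltr0n // ler_nat.
Qed.

Lemma psum_tseq q m : (m <= q)%N -> psum (tseq q) m = vseq m.
Proof.
move=> mq; rewrite -psum_sseq; apply: eq_bigr => i _.
by rewrite /tseq; congr sseq; have := ltn_ord i; lia.
Qed.

Lemma sum_sqr_tseq_le (q n : nat) : (q < n)%N ->
  \sum_(t < n) tseq q t ^+ 2 <= \sum_(t < q.+1) sseq t ^+ 2 + n%:R * sseq q ^+ 2.
Proof.
move=> /subnKC <-; rewrite big_split_ord /= lerD //.
  apply: ler_sum => t _; have tq := ltn_ord t.
  by have -> : tseq q t = sseq t by rewrite /tseq; congr sseq; lia.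
rewrite (eq_bigr (fun=> sseq q ^+ 2)) => [|t _]; last first.
  by rewrite /tseq; congr (sseq _ ^+ 2); lia.
by rewrite sum_ord_const ler_wpM2r ?sqr_ge0 // ler_nat leq_addl.
Qed.

End BinomialSequences.

Arguments sseq {R} dl m.
Arguments vseq {R} dl m.
Arguments tseq {R} dl q m.

(** * Power bounds for the binomial coefficients and elementary sums *)

Section PowerBounds.
Variable R : realType.
Implicit Types (x dl : R).

(** Weighted arithmetic-geometric mean of 1 + x and 1. Both are divided by their mean 1 + dl x; the
    tangent bounds ln z <= z - 1, weighted by dl and 1 - dl, then add up to 0. *)
Lemma bernoulli_powR x dl : -1 < x -> 0 <= dl <= 1 -> (1 + x) `^ dl <= 1 + dl * x.
Proof.
move=> x1 /andP[dl0 dl1].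
have y0 : 0 < 1 + x by lra.
have A0 : 0 < 1 + dl * x by case: (lerP 0 x) => x0; nra.
rewrite -ler_ln ?posrE ?powR_gt0 // ln_powR.
have tangent (z : R) : 0 < z -> ln z <= z - 1.
  by move=> z0; rewrite -{1}[z](subrKC 1) le_ln1Dx //; lra.
have := ler_wpM2l dl0 (tangent _ (divr_gt0 y0 A0)).
have dl1' : 0 <= 1 - dl by lra.
have := ler_wpM2l dl1' (tangent _ (divr_gt0 ltr01 A0)).
rewrite !ln_div ?posrE // ln1.
have E : dl * ((1 + x) / (1 + dl * x) - 1) + (1 - dl) * (1 / (1 + dl * x) - 1) = 0.
  by field; lra.
by lra.
Qed.

(** By Bernoulli each factor 1 + dl/j is at least ((j + 1)/j)^dl, and these telescope. *)
Lemma vseq_ge dl m : 0 < dl -> dl < 1 -> m.+1%:R `^ dl <= vseq dl m.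
Proof.
move=> dl0 dl1; elim: m => [|m IH]; first by rewrite vseq0 powR1.
have m0 : 0 < m.+1%:R :> R by rewrite ltr0n.
have mV : 0 < m.+1%:R^-1 :> R by rewrite invr_gt0.
have -> : m.+2%:R = m.+1%:R * (1 + m.+1%:R^-1) :> R by rewrite -[m.+2%:R]natr1; field; lra.
rewrite powRM //; last by rewrite addr_ge0 // ltW.
rewrite vseqS ler_pM ?powR_ge0 //.
by apply: bernoulli_powR; [rewrite (lt_trans _ mV) // ltrN10 | rewrite !ltW].
Qed.

(** The factor 2 comes from v_1 = 1 + dl. With z = 1/(m + 2), the induction step reduces to (1 - dl
    z)(1 + dl z) <= 1. *)
Lemma vseq_le dl m : 0 < dl -> dl < 1 -> vseq dl m.+1 <= 2 * m.+1%:R `^ dl.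
Proof.
move=> dl0 dl1; elim: m => [|m IH].
  by rewrite vseqS vseq0 powR1; lra.
have m0 : 0 < m.+1%:R :> R by rewrite ltr0n.
have m2 : 0 < m.+2%:R :> R by rewrite ltr0n.
rewrite vseqS.
apply: (@le_trans _ _ (2 * m.+1%:R `^ dl * (1 + dl / m.+2%:R))).
  by rewrite ler_wpM2r // addr_ge0 // divr_ge0 ?ltW.
rewrite -mulrA ler_pM2l //.
have E : m.+1%:R = m.+2%:R * (1 + - m.+2%:R^-1) :> R.
  by rewrite -[m.+2%:R]natr1; field; lra.
have mV : 0 < m.+2%:R^-1 :> R by rewrite invr_gt0.
have mV1 : m.+2%:R^-1 < 1 :> R by rewrite invf_lt1 // ltr1n.
rewrite E powRM //; last by rewrite subr_ge0 ltW.
rewrite -mulrA ger_pMr ?powR_gt0 //.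
have := @bernoulli_powR (- m.+2%:R^-1) dl.
move: {E} (m.+2%:R^-1) mV mV1 => z mV mV1.
move=> /(_ ltac:(lra) ltac:(apply/andP; split; lra)) bern.
apply: (@le_trans _ _ ((1 + dl * - z) * (1 + dl * z))).
  by rewrite ler_wpM2r //; nra.
by nra.
Qed.

Lemma harmonic_le m : \sum_(i < m.+1) (i.+1%:R : R)^-1 <= 1 + ln m.+1%:R.
Proof.
elim: m => [|m IH]; first by rewrite big_ord1 ln1 invr1 addr0.
rewrite big_ord_recr /=.
have m1 : 0 < m.+1%:R :> R by rewrite ltr0n.
have m2 : 0 < m.+2%:R :> R by rewrite ltr0n.
have : ln (m.+1%:R / m.+2%:R) <= - m.+2%:R^-1 :> R.
  have -> : m.+1%:R / m.+2%:R = 1 + - m.+2%:R^-1 :> R.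
    by rewrite -[m.+2%:R]natr1; field; lra.
  by apply: le_ln1Dx; rewrite ltrN2 invf_lt1 // ltr1n.
by rewrite ln_div ?posrE //; move: (m.+2%:R^-1) => z; lra.
Qed.

Lemma sum_inv_sqrt_le m : \sum_(i < m) (Num.sqrt (i.+1%:R : R))^-1 <= 2 * Num.sqrt m%:R.
Proof.
elim: m => [|m IH]; first by rewrite big_ord0 sqrtr0 mulr0.
rewrite big_ord_recr /=.
have a0 : 0 < Num.sqrt m.+1%:R :> R by rewrite sqrtr_gt0 ltr0n.
have c0 : 0 <= Num.sqrt m%:R :> R by rewrite sqrtr_ge0.
have : Num.sqrt m.+1%:R ^+ 2 = Num.sqrt m%:R ^+ 2 + 1 :> R.
  by rewrite !sqr_sqrtr ?ler0n // natr1.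
move: IH a0 c0; set a := Num.sqrt m.+1%:R; set c := Num.sqrt m%:R => IH a0 c0 aa.
(* Since a^2 = c^2 + 1, this amounts to (a - c)^2 >= 0. *)
suff : a^-1 <= 2 * a - 2 * c by lra.
rewrite -[a^-1]mul1r ler_pdivrMr // -subr_ge0.
have -> : (2 * a - 2 * c) * a - 1 = (a - c) ^+ 2 + (a ^+ 2 - (c ^+ 2 + 1)) by ring.
by rewrite aa subrr addr0 sqr_ge0.
Qed.

Lemma sum_inv_sqr_le m : \sum_(i < m) ((i.+1%:R : R) ^+ 2)^-1 <= 2.
Proof.
(* The correction -1/(k + 1) makes the bound inductive. *)
suff H k : \sum_(i < k.+1) ((i.+1%:R : R) ^+ 2)^-1 <= 2 - k.+1%:R^-1.
  case: m => [|m]; first by rewrite big_ord0.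
  by apply: le_trans (H m) _; rewrite gerBl invr_ge0.
elim: k => [|k IH]; first by rewrite big_ord1 expr1n invr1; lra.
rewrite big_ord_recr /=; apply: le_trans (lerD IH (lexx _)) _.
have k1 : 0 < k.+1%:R :> R by rewrite ltr0n.
rewrite -[k.+2%:R]natr1; set x : R := k.+1%:R in k1 *.
have x1 : 0 < x + 1 by lra.
rewrite -subr_ge0.
have -> : 2 - (x + 1)^-1 - (2 - x^-1 + ((x + 1) ^+ 2)^-1) = (x * (x + 1) ^+ 2)^-1.
  by field; apply/andP; split; lra.
by rewrite invr_ge0 mulr_ge0 ?exprn_ge0 // ltW.
Qed.

Lemma ln2_ge : 3 / 5 <= ln 2 :> R.
Proof.
(* As 1/2 <= (17/20)^4, about 0.522, four tangent bounds ln(17/20) <= -3/20 give 3/5. *)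
have : ln (2^-1) <= ln ((1 + - (3 / 20)) ^+ 4) :> R.
  by rewrite ler_ln ?posrE; lra.
rewrite lnV ?posrE // lnXn; last by lra.
have : ln (1 + - (3 / 20)) <= - (3 / 20) :> R by apply: le_ln1Dx; lra.
by rewrite -mulr_natl; lra.
Qed.

End PowerBounds.

(** * The matrices B and C as Toeplitz matrices, and the error bound *)

Section Factorization.
Implicit Types (dl : RR).

Lemma ctilS (g : RR) m : ctil g m.+1 = - (ctil g m * ((g - m%:R) / m.+1%:R)).
Proof.
rewrite /ctil /gbinom big_nat_recr //= exprS.
have -> : g + 1 - m.+1%:R = g - m%:R by rewrite -natr1; ring.
by ring.
Qed.

(** Coefficientwise form of (1 - x)^(1-dl) = (1 - x) (1 - x)^(-dl). *)
Lemma ctil_sseq dl m : ctil (1 - dl) m.+1 = sseq dl m.+1 - sseq dl m.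
Proof.
have E : ctil (1 - dl) m.+1 = - ((1 - dl) / m.+1%:R * sseq dl m).
  elim: m => [|m IH].
    by rewrite ctilS /ctil /gbinom big_geq // sseq0 expr0; ring.
  have m0 : 0 <= m%:R :> RR by rewrite ler0n.
  rewrite ctilS IH sseqS -[m.+2%:R]natr1 -[m.+1%:R]natr1; field.
  by clear IH; apply/andP; split; lra.
by rewrite E sseqS; ring.
Qed.

Definition cseq dl q r : RR := if (r < q.+1)%N then ctil (1 - dl) r else 0.

(** The differences telescope up to [q]; truncation to bandwidth q + 1 then freezes the partial sums
    at s_q. *)
Lemma psum_cseq dl q m : psum (cseq dl q) m = tseq dl q m.
Proof.
elim: m => [|m IH].
  by rewrite psum0 tseq0 /cseq /= /ctil /gbinom big_geq // mulr1.
rewrite psumS IH /cseq /tseq ltnS; case: ifP => mq.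
  by rewrite (minn_idPl mq) (minn_idPl (ltnW mq)) ctil_sseq addrC subrK.
by rewrite addr0; congr sseq; lia.
Qed.

Lemma Cinv_toep n q dl : Cinv n q.+1 (1 - dl) = toep n (cseq dl q).
Proof.
by apply/matrixP => i j; rewrite !mxE /cseq; case: (j <= i)%N.
Qed.

Lemma Bmat_toep n q dl : Bmat n q.+1 (1 - dl) = toep n (tseq dl q).
Proof.
have -> : Bmat n q.+1 (1 - dl) = toep n (fun=> 1) *m toep n (cseq dl q).
  by rewrite /Bmat Cinv_toep; congr (_ *m _); apply/matrixP => i j; rewrite !mxE.
rewrite mul_toep; apply/matrixP => i j; rewrite !mxE.
by rewrite conv1_psum psum_cseq.
Qed.

(** Since c(x) = (1 - x) t(x), the inverse series is 1/((1 - x) t(x)). In coefficients, conv of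
    [cseq] with it is the difference of a constant sequence 1. *)
Lemma Cmat_toep n q dl :
  Cmat n q.+1 (1 - dl) = toep n (psum (recip (tseq dl q))).
Proof.
rewrite /Cmat Cinv_toep; apply: invmx_toep => m.
have b0 := tseq0 RR dl q; set f := tseq dl q in b0 *.
have ones k : conv (psum (cseq dl q)) (psum (recip f)) k = 1.
  rewrite -(conv_psum_recip RR f k b0); apply: eq_bigr => i _.
  by rewrite psum_cseq.
case: m => [|m] /=.
  by rewrite -(ones 0%N) /conv !big_ord1 /= !psum0.
have := ones m.+1; rewrite conv_psuml ones => /eqP.
by rewrite -subr_eq0 addrAC subrr add0r => /eqP.
Qed.

Lemma entry_toep n (f : nat -> RR) (i : 'I_n) (m : nat) :
  entry (toep n f) i m = if (m <= i)%N then f (i - m)%N else 0.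
Proof.
(* A column index outside the matrix exceeds every row, so the default 0 of [entry] agrees with the
   formula. *)
rewrite /entry; case: insubP => [j _ <-|]; first by rewrite mxE.
by rewrite -leqNgt => nm; rewrite leqNgt (leq_trans (ltn_ord i) nm).
Qed.

(** Separates the problem into scalar estimates: [F] bounds the squared Frobenius norm over n, [S]
    the squared sensitivity over k. The factor sqrt n cancels. *)
Lemma rmse_le n q k b dl (F S : RR) :
    0 < dl -> dl < 1 -> (q < n)%N -> (0 < b)%N ->
    \sum_(t < q.+1) sseq dl t ^+ 2 + n%:R * sseq dl q ^+ 2 <= F ->
    \sum_(t < q.+1) (vseq dl t ^+ 2)^-1 + (vseq dl q * sseq dl q)^-1
      + 2 * (b%:R * sseq dl q ^+ 2)^-1 <= S ->
  rmse k b (Bmat n q.+1 (1 - dl)) (Cmat n q.+1 (1 - dl)) <=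
  Num.sqrt (F * (k%:R * S)).
Proof.
move=> dl0 dl1 qn b0 leF leS; have n0 : 0 < n%:R :> RR by rewrite ltr0n; lia.
have f0 := tseq0 RR dl q; have f_gt0 := tseq_gt0 RR dl dl0 q.
have f_dec := tseq_dec RR dl dl0 dl1 q; have f_convex := tseq_convex RR dl dl0 dl1 q.
have s0 := sseq_gt0 RR dl dl0 q; have v0 := vseq_gt0 RR dl dl0.
rewrite Bmat_toep Cmat_toep; set f := tseq dl q in f0 f_gt0 f_dec f_convex *.
set d := psum (recip f).
have d0 : forall i, 0 <= d i by exact: psum_recip_ge0.
have d_dec : forall i j, (i <= j)%N -> d j <= d i by exact: psum_recip_dec.
have d_sum := sum_psum_recip_le1 RR f f0 f_dec _ (tseq_ge RR dl dl0 dl1 q).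
have dv m : (m <= q)%N -> d m * vseq dl m <= 1.
  by move=> mq; rewrite -(psum_tseq RR dl dl0 dl1 q) // psum_recip_mul_le1.
have frob_le : frob (toep n f) <= Num.sqrt n%:R * Num.sqrt F.
  rewrite -sqrtrM ?ler0n // ler_wsqrtr // (le_trans (toep_frob_le _ _ _)) //.
  by rewrite ler_wpM2l ?ler0n // (le_trans _ leF) // sum_sqr_tseq_le.
have sens_le : sens k b (toep n d) <= Num.sqrt (k%:R * S).
  rewrite ler_wsqrtr //.
  under eq_bigr => i _ do (under eq_bigr => j _ do rewrite entry_toep).
  apply: le_trans (sens_sum_le RR d _ n k b d0 d_dec s0 d_sum b0) _.
  rewrite ler_wpM2l ?ler0n // (le_trans _ leS) // lerD2r; apply: sum_sqr_le => //.
  (* Past the bandwidth monotonicity gives d_i <= d_q <= 1/v_q. *)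
  move=> i qi; apply: le_trans (dv q (leqnn q)).
  by rewrite ler_wpM2r ?(ltW (v0 _)) // d_dec // ltnW.
have F0 : 0 <= F.
  apply: le_trans leF; apply: addr_ge0; last by rewrite mulr_ge0 ?sqr_ge0 ?ler0n.
  by apply: sumr_ge0 => t _; rewrite sqr_ge0.
rewrite /rmse sqrtrM // ler_pdivrMr ?sqrtr_gt0 // mulrAC [X in _ <= X * _]mulrC.
by rewrite ler_pM ?sqrtr_ge0.
Qed.

End Factorization.

(** * Estimates for gamma near 1/2 *)

Section NearOneHalf.
Variable R : realType.
Implicit Types (dl x P : R).

(** The exponent 2 dl differs from 1 so little that x^(2 dl) is within a factor e^(1/2) of x, and
    1/2 < 3/5 <= ln 2. *)
Lemma near_half_powR dl x P : 2 <= P -> 1 <= x <= P ->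
    `|dl - 2^-1| <= (4 * ln P)^-1 ->
  (x `^ dl) ^+ 2 <= 2 * x /\ x <= 2 * (x `^ dl) ^+ 2.
Proof.
move=> P2 /andP[x1 xP] dlP; have ln2 := ln2_ge R.
have x0 : 0 < x by lra.
have P0 : 0 < P by lra.
have lP : ln 2 <= ln P by rewrite ler_ln ?posrE.
have lx0 : 0 <= ln x by rewrite ln_ge0.
have lxP : ln x <= ln P by rewrite ler_ln ?posrE.
have : `|(dl - 2^-1) * ln x| <= 4^-1.
  rewrite normrM (ger0_norm lx0).
  apply: (@le_trans _ _ ((4 * ln P)^-1 * ln P)); first by rewrite ler_pM.
  by rewrite invfM -mulrA mulVf ?mulr1 //; lra.
rewrite ler_norml => /andP[lo hi].
have y0 : 0 < (x `^ dl) ^+ 2 by rewrite exprn_gt0 // powR_gt0.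
have lnE : ln ((x `^ dl) ^+ 2) = 2 * (dl * ln x).
  by rewrite lnXn ?powR_gt0 // ln_powR [RHS]mulr_natl.
have x20 : 0 < 2 * x by rewrite mulr_gt0.
have y20 : 0 < 2 * (x `^ dl) ^+ 2 by rewrite mulr_gt0.
split; first by rewrite -ler_ln ?posrE // lnM ?posrE // lnE; lra.
by rewrite -ler_ln ?posrE // lnM ?posrE // lnE; lra.
Qed.

Variables (dl : R) (q : nat).

Lemma near_half_bounds : (0 < q)%N -> `|dl - 2^-1| <= (4 * ln q.+1%:R)^-1 ->
  3 / 5 <= ln (q.+1%:R : R) /\ 12^-1 <= dl.
Proof.
move=> q0 dlP; have ln2 := ln2_ge R.
have lP : 3 / 5 <= ln (q.+1%:R : R).
  by apply: le_trans ln2 _; rewrite ler_ln ?posrE ?ltr0n // ler_nat.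
split=> //.
(* Here 1/(4 * 3/5) = 5/12, leaving dl >= 1/2 - 5/12 = 1/12. *)
have : (4 * ln q.+1%:R)^-1 <= 5 / 12 :> R.
  by rewrite -[leLHS]mul1r ler_pdivrMr; lra.
by move: dlP; rewrite ler_norml => /andP[]; move: (_^-1 : R) => z; lra.
Qed.

Lemma near_half_vseq_ge m : 0 < dl -> dl < 1 -> (0 < q)%N -> (m <= q)%N ->
    `|dl - 2^-1| <= (4 * ln q.+1%:R)^-1 ->
  (vseq dl m ^+ 2)^-1 <= 2 / m.+1%:R.
Proof.
move=> dl0 dl1 q0 mq dlP.
have [||_ lo] := @near_half_powR dl m.+1%:R q.+1%:R _ _ dlP.
- by rewrite ler_nat.
- by rewrite ler1n ler_nat.
have m0 : 0 < m.+1%:R :> R by rewrite ltr0n.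
have v0 := vseq_gt0 R dl dl0 m.
rewrite ler_pdivlMr // mulrC ler_pdivrMr ?exprn_gt0 //.
apply: le_trans lo _; rewrite ler_pM2l // ler_pXn2r ?nnegrE ?powR_ge0 ?(ltW v0) //.
exact: vseq_ge.
Qed.

(** For m >= 1, v_m^2 <= 4 m^(2 dl) <= 8 m, so s_m^2 <= 8/m <= 16/(m + 1). *)
Lemma near_half_sseq_le m : 0 < dl -> dl < 1 -> (0 < q)%N -> (m <= q)%N ->
    `|dl - 2^-1| <= (4 * ln q.+1%:R)^-1 ->
  sseq dl m ^+ 2 <= 16 / m.+1%:R.
Proof.
move=> dl0 dl1 q0 mq dlP; case: m mq => [|m] mq.
  by rewrite sseq0 expr1n divr1 ler1n.
have [||hi _] := @near_half_powR dl m.+1%:R q.+1%:R _ _ dlP.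
- by rewrite ler_nat.
- by rewrite ler1n ler_nat; lia.
have v0 := vseq_gt0 R dl dl0 m.+1.
have v_le : vseq dl m.+1 ^+ 2 <= 8 * m.+1%:R.
  have := vseq_le R dl m dl0 dl1.
  by have := powR_ge0 (m.+1%:R : R) dl; nra.
have x1 : 1 <= m.+1%:R :> R by rewrite ler1n.
rewrite sseqE // expr_div_n -[m.+2%:R]natr1.
move: {hi} (vseq _ _) (m.+1%:R) v0 v_le x1 => v x v0 v_le x1.
rewrite ler_pdivlMr; last by lra.
rewrite mulrAC ler_pdivrMr; last by rewrite exprn_gt0 //; lra.
apply: (@le_trans _ _ (8 * x * (x + 1))).
  rewrite ler_wpM2r //; first by lra.
  apply: le_trans v_le; rewrite exprMn ler_piMl ?sqr_ge0 //.
  by rewrite expr_le1 // ltW.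
by nra.
Qed.

Lemma near_half_frob_le (N : R) : 0 < dl -> dl < 1 -> (0 < q)%N -> 0 <= N ->
    `|dl - 2^-1| <= (4 * ln q.+1%:R)^-1 ->
  \sum_(t < q.+1) sseq dl t ^+ 2 + N * sseq dl q ^+ 2
    <= 48 * (ln q.+1%:R + N / q.+1%:R).
Proof.
move=> dl0 dl1 q0 N0 dlP; have [lP _] := near_half_bounds q0 dlP.
have sum_le : \sum_(t < q.+1) sseq dl t ^+ 2 <= 16 * (1 + ln q.+1%:R).
  apply: (@le_trans _ _ (16 * \sum_(t < q.+1) (t.+1%:R : R)^-1)); last first.
    by rewrite ler_pM2l // harmonic_le.
  rewrite mulr_sumr; apply: ler_sum => t _; apply: near_half_sseq_le => //.
  by rewrite -ltnS.
(* The constant 16 left by the harmonic sum is absorbed by 32 ln(q + 1), as ln(q + 1) >= 3/5; hence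
   48. *)
have := ler_wpM2l N0 (near_half_sseq_le q dl0 dl1 q0 (leqnn q) dlP).
have : 0 <= N / q.+1%:R by rewrite divr_ge0.
by rewrite [N * (16 / _)]mulrCA; move: (N / _) => z; lra.
Qed.

Lemma near_half_sens_le (B : R) : 0 < dl -> dl < 1 -> (0 < q)%N -> 0 < B ->
    `|dl - 2^-1| <= (4 * ln q.+1%:R)^-1 ->
  \sum_(t < q.+1) (vseq dl t ^+ 2)^-1 + (vseq dl q * sseq dl q)^-1
    + 2 * (B * sseq dl q ^+ 2)^-1 <= 576 * (ln q.+1%:R + q.+1%:R / B).
Proof.
move=> dl0 dl1 q0 B0 dlP; have [lP dl_ge] := near_half_bounds q0 dlP.
have sum_le : \sum_(t < q.+1) (vseq dl t ^+ 2)^-1 <= 2 * (1 + ln q.+1%:R).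
  apply: (@le_trans _ _ (2 * \sum_(t < q.+1) (t.+1%:R : R)^-1)); last first.
    by rewrite ler_pM2l // harmonic_le.
  rewrite mulr_sumr; apply: ler_sum => t _; apply: near_half_vseq_ge => //.
  by rewrite -ltnS.
have V0 := vseq_gt0 R dl dl0 q.
have P0 : 0 < q.+1%:R :> R by rewrite ltr0n.
have dlV : dl^-1 <= 12 by rewrite -[leLHS]mul1r ler_pdivrMr //; lra.
have V_le := near_half_vseq_ge q dl0 dl1 q0 (leqnn q) dlP.
have qdl : 0 < q%:R + dl by rewrite ltr_wpDl.
have qdl_le : q%:R + dl <= q.+1%:R by rewrite -natr1 lerD2l ltW.
(* Both remaining terms use s_q = dl v_q/(q + dl) with 1/dl <= 12 and 1/v_q^2 <= 2/(q + 1): here 12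
   * 2 = 24, below 144 * 2 = 288. *)
have Vs_le : (vseq dl q * sseq dl q)^-1 <= 24.
  have -> : (vseq dl q * sseq dl q)^-1 = dl^-1 * ((vseq dl q ^+ 2)^-1 * (q%:R + dl)).
    rewrite sseqE //; field.
    by apply/and3P; split; rewrite gt_eqF.
  have -> : 24 = 12 * (2 / q.+1%:R * q.+1%:R) :> R by rewrite divfK ?gt_eqF //; ring.
  rewrite ler_pM ?invr_ge0 ?(ltW dl0) //.
    by rewrite mulr_ge0 ?invr_ge0 ?sqr_ge0 // ltW.
  by rewrite ler_pM ?invr_ge0 ?sqr_ge0 // ltW.
have s_le : (sseq dl q ^+ 2)^-1 <= 288 * q.+1%:R.
  have -> : (sseq dl q ^+ 2)^-1 = dl^-1 ^+ 2 * ((vseq dl q ^+ 2)^-1 * (q%:R + dl) ^+ 2).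
    rewrite sseqE //; field.
    by apply/and3P; split; rewrite gt_eqF.
  have -> : 288 * q.+1%:R = 12 ^+ 2 * (2 / q.+1%:R * q.+1%:R ^+ 2) :> R.
    by move: (q.+1%:R) P0 => z z0; field; rewrite gt_eqF.
  have dlV0 : 0 <= dl^-1 by rewrite invr_ge0 ltW.
  have vV0 : 0 <= (vseq dl q ^+ 2)^-1 by rewrite invr_ge0 sqr_ge0.
  apply: ler_pM; first exact: sqr_ge0.
  - by rewrite mulr_ge0 ?sqr_ge0.
  - by rewrite ler_pXn2r ?nnegrE.
  apply: ler_pM => //; first exact: sqr_ge0.
  by rewrite ler_pXn2r ?nnegrE // ltW.
have : (B * sseq dl q ^+ 2)^-1 <= 288 * (q.+1%:R / B).
  rewrite invfM mulrA [leRHS]mulrC.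
  by rewrite ler_pM2l ?invr_gt0.
by move: (q.+1%:R / B) ((B * _)^-1) => z w; lra.
Qed.

End NearOneHalf.

(** * Estimates for gamma = 1 - p/sqrt n, with r standing for sqrt n *)

Section NearOne.
Variable R : realType.
Variables (dl r : R) (q : nat).

Lemma near_one_frob_le : 0 < dl -> dl <= 4^-1 -> (0 < q)%N -> 0 < r ->
    dl * r = q.+1%:R ->
  \sum_(t < q.+1) sseq dl t ^+ 2 + r ^+ 2 * sseq dl q ^+ 2
    <= 18 * (q.+1%:R `^ dl) ^+ 2.
Proof.
move=> dl0 dl4 q0 r0 dlr; have dl1 : dl < 1 by lra.
set W := q.+1%:R `^ dl.
have W1 : 1 <= W by rewrite -(powRr0 q.+1%:R) ler_powR ?ler1n // ltW.
have s_le m : (m < q)%N -> sseq dl m.+1 <= 2 * dl * W / m.+1%:R.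
  move=> mq; have m0 : 0 < m.+1%:R :> R by rewrite ltr0n.
  rewrite sseqE //; apply: ler_pM.
  - by rewrite mulr_ge0 // ltW // vseq_gt0.
  - by rewrite invr_ge0 addr_ge0 // ltW.
  - rewrite [2 * dl]mulrC -mulrA ler_pM2l //; apply: le_trans (vseq_le _ _ _ dl0 dl1) _.
    rewrite ler_pM2l // ge0_ler_powR ?nnegrE ?(ltW dl0) // ler_nat; lia.
  - by rewrite lef_pV2 ?posrE ?addr_gt0 // lerDl ltW.
have s0 m : 0 <= sseq dl m by rewrite ltW // sseq_gt0.
(* The term at 0 is 1; as 2 dl <= 1/2, the others are at most (W/(2m))^2, and the inverse squares
   sum to at most 2. *)
have sum_le : \sum_(t < q.+1) sseq dl t ^+ 2 <= 1 + W ^+ 2 / 2.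
  rewrite big_ord_recl sseq0 expr1n lerD2l.
  apply: (@le_trans _ _ (W ^+ 2 / 4 * \sum_(i < q) ((i.+1%:R : R) ^+ 2)^-1)).
    rewrite mulr_sumr; apply: ler_sum => i _ /=.
    have m0 : 0 < i.+1%:R :> R by rewrite ltr0n.
    have -> : W ^+ 2 / 4 * (i.+1%:R ^+ 2)^-1 = (W / 2 / i.+1%:R) ^+ 2.
      by move: (i.+1%:R) m0 => z z0; field; rewrite gt_eqF.
    have W20 : 0 <= W / 2 by lra.
    rewrite ler_pXn2r ?nnegrE ?s0 //; last by rewrite divr_ge0.
    apply: le_trans (s_le _ (ltn_ord i)) _.
    by rewrite ler_pM2r ?invr_gt0 //; nra.
  apply: (@le_trans _ _ (W ^+ 2 / 4 * 2)); last by lra.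
  by rewrite ler_wpM2l ?sum_inv_sqr_le // divr_ge0 ?sqr_ge0.
(* From dl r = q + 1 and (q + 1)/q <= 2. *)
have rs_le : r * sseq dl q <= 4 * W.
  have := s_le q.-1; rewrite prednK // => /(_ (leqnn q)) sq_le.
  have q1 : 1 <= q%:R :> R by rewrite ler1n.
  apply: le_trans (ler_wpM2l (ltW r0) sq_le) _.
  rewrite mulrA ler_pdivrMr; last by lra.
  have -> : r * (2 * dl * W) = 2 * W * (dl * r) by ring.
  by rewrite dlr -natr1; nra.
rewrite -exprMn.
have : (r * sseq dl q) ^+ 2 <= (4 * W) ^+ 2.
  by rewrite ler_pXn2r ?nnegrE ?mulr_ge0 ?s0 ?powR_ge0 // ltW.
by rewrite exprMn; nra.
Qed.

(** For y = (q + 1)/(m + 1) >= 1, dl <= 1/4 gives y^(2 dl) <= sqrt y. This pulls out the factor (q +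
    1)^(-2 dl) that later cancels the Frobenius bound. *)
Lemma near_one_vseq_ge m : 0 < dl -> dl <= 4^-1 -> (m <= q)%N ->
  (vseq dl m ^+ 2)^-1 <=
  Num.sqrt q.+1%:R / (q.+1%:R `^ dl) ^+ 2 * (Num.sqrt m.+1%:R)^-1.
Proof.
move=> dl0 dl4 mq; have dl1 : dl < 1 by lra.
have x0 : 0 < m.+1%:R :> R by rewrite ltr0n.
have v0 := vseq_gt0 R dl dl0 m; have v_ge := vseq_ge R dl m dl0 dl1.
have y1 : 1 <= q.+1%:R / m.+1%:R :> R by rewrite ler_pdivlMr // mul1r ler_nat.
have -> : q.+1%:R = m.+1%:R * (q.+1%:R / m.+1%:R) :> R.
  by rewrite mulrC divfK ?gt_eqF.
move: (m.+1%:R) (q.+1%:R / _) x0 v_ge y1 => x y x0 v_ge y1.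
have y0 : 0 < y by lra.
have y_le : (y `^ dl) ^+ 2 <= Num.sqrt y.
  rewrite -powR12_sqrt ?(ltW y0) // -powR_mulrn ?powR_ge0 // -powRrM.
  by rewrite ler_powR //; lra.
rewrite powRM ?(ltW x0) ?(ltW y0) // sqrtrM ?(ltW x0) //.
have sx0 : 0 < Num.sqrt x by rewrite sqrtr_gt0.
have X0 : 0 < x `^ dl by rewrite powR_gt0.
have Y0 : 0 < y `^ dl by rewrite powR_gt0.
have -> : Num.sqrt x * Num.sqrt y / (x `^ dl * y `^ dl) ^+ 2 * (Num.sqrt x)^-1
    = (Num.sqrt y / (y `^ dl) ^+ 2) * ((x `^ dl) ^+ 2)^-1.
  by field; rewrite !gt_eqF.
rewrite -[leLHS]mul1r; apply: ler_pM => //.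
- by rewrite invr_ge0 sqr_ge0.
- by rewrite ler_pdivlMr ?exprn_gt0 // mul1r.
by rewrite lef_pV2 ?posrE ?exprn_gt0 // ler_pXn2r ?nnegrE ?(ltW X0) ?(ltW v0).
Qed.

Lemma near_one_sens_le (B : R) : 0 < dl -> dl <= 4^-1 -> (0 < q)%N -> 0 < r -> 0 < B ->
    dl * r = q.+1%:R ->
  \sum_(t < q.+1) (vseq dl t ^+ 2)^-1 + (vseq dl q * sseq dl q)^-1
    + 2 * (B * sseq dl q ^+ 2)^-1 <= 2 * (r + r ^+ 2 / B) / (q.+1%:R `^ dl) ^+ 2.
Proof.
move=> dl0 dl4 q0 r0 B0 dlr; have dl1 : dl < 1 by lra.
have P0 : 0 < q.+1%:R :> R by rewrite ltr0n.
have V0 := vseq_gt0 R dl dl0 q; have V_ge := vseq_ge R dl q dl0 dl1.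
have s0 := sseq_gt0 R dl dl0 q.
have W0 : 0 < q.+1%:R `^ dl :> R by rewrite powR_gt0.
have sum_le : \sum_(t < q.+1) (vseq dl t ^+ 2)^-1 <=
    2 * q.+1%:R / (q.+1%:R `^ dl) ^+ 2.
  apply: (@le_trans _ _ (\sum_(t < q.+1)
      (Num.sqrt q.+1%:R / (q.+1%:R `^ dl) ^+ 2 * (Num.sqrt (t.+1%:R : R))^-1))).
    by apply: ler_sum => t _; apply: near_one_vseq_ge => //; rewrite -ltnS.
  rewrite -mulr_sumr.
  apply: le_trans (ler_wpM2l _ (sum_inv_sqrt_le R q.+1)) _.
    by rewrite divr_ge0 ?sqrtr_ge0 ?sqr_ge0.
  rewrite le_eqVlt; apply/orP; left; apply/eqP.
  move: ((_ `^ _) ^+ 2) => w.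
  by rewrite -[in RHS](sqr_sqrtr (ler0n R q.+1)); ring.
have s_ge : q.+1%:R `^ dl / r <= sseq dl q.
  have -> : q.+1%:R `^ dl / r = dl * q.+1%:R `^ dl / q.+1%:R.
    by rewrite -dlr; field; rewrite !gt_eqF.
  rewrite sseqE //; apply: ler_pM.
  - by rewrite mulr_ge0 // ltW.
  - by rewrite invr_ge0.
  - by rewrite ler_pM2l.
  - by rewrite lef_pV2 ?posrE ?ltr_wpDl // -natr1 lerD2l ltW.
(* The bandwidth is at most r/4, so the 2P from the sum of squares is absorbed into 2r. *)
have P_le : q.+1%:R <= r / 4 by rewrite -dlr; nra.
move: (q.+1%:R) (q.+1%:R `^ dl) W0 s_ge sum_le V_ge P_le {dlr} P0
  => P W W0 s_ge sum_le V_ge P_le P0.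
have Wr0 : 0 < W / r by rewrite divr_gt0.
have Vs_le : (vseq dl q * sseq dl q)^-1 <= r / W ^+ 2.
  have -> : r / W ^+ 2 = (W * (W / r))^-1 by field; rewrite !gt_eqF.
  rewrite lef_pV2 ?posrE; try by rewrite mulr_gt0.
  by apply: ler_pM => //; exact: ltW.
have ss_le : (B * sseq dl q ^+ 2)^-1 <= r ^+ 2 / B / W ^+ 2.
  have -> : r ^+ 2 / B / W ^+ 2 = (B * (W / r) ^+ 2)^-1 by field; rewrite !gt_eqF.
  rewrite lef_pV2 ?posrE; try by rewrite mulr_gt0 ?exprn_gt0.
  by rewrite ler_pM2l // ler_pXn2r ?nnegrE // ltW.
apply: le_trans (lerD (lerD sum_le Vs_le) (ler_wpM2l _ ss_le)) _ => //.
have -> : 2 * P / W ^+ 2 + r / W ^+ 2 + 2 * (r ^+ 2 / B / W ^+ 2)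
    = (2 * P + r + 2 * (r ^+ 2 / B)) / W ^+ 2 by ring.
rewrite ler_pM2r ?invr_gt0 ?exprn_gt0 //.
by move: (r ^+ 2 / B) => z; lra.
Qed.

End NearOne.

(** * Subadditivity of the square root and assembly of the two bounds *)

Lemma sqrtrD_le (R : realType) (x y : R) : 0 <= x -> 0 <= y ->
  Num.sqrt (x + y) <= Num.sqrt x + Num.sqrt y.
Proof.
move=> x0 y0; have sx := sqrtr_ge0 x; have sy := sqrtr_ge0 y.
rewrite -(@ler_pXn2r _ 2) ?nnegrE ?sqrtr_ge0 ?addr_ge0 // sqr_sqrtr ?addr_ge0 //.
by rewrite sqrrD !sqr_sqrtr // lerD2r lerDl mulrn_wge0 ?mulr_ge0.
Qed.

Theorem mainTheorem1 :
  exists K : RR, 0 < K /\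
  forall n p k b : nat,
    (2 <= p)%N -> (p <= n)%N -> (1 <= k)%N -> (1 <= b)%N ->
    k%:RR <= n%:RR / b%:RR ->
    (forall g : RR, 0 < g -> g < 1 ->
       `|g - 2^-1| <= (4 * ln p%:RR)^-1 ->
       rmse k b (Bmat n p g) (Cmat n p g)
         <= K * (Num.sqrt k%:RR * ln p%:RR
                 + Num.sqrt (n%:RR * k%:RR / b%:RR)
                 + Num.sqrt (n%:RR * k%:RR * ln p%:RR / p%:RR)
                 + Num.sqrt (k%:RR * p%:RR * ln p%:RR / b%:RR)))
    /\
    (p%:RR <= Num.sqrt n%:RR / 4 ->
       let g := 1 - p%:RR / Num.sqrt n%:RR in
       rmse k b (Bmat n p g) (Cmat n p g)
         <= K * (Num.sqrt k%:RR * Num.sqrt (Num.sqrt n%:RR)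
                 + Num.sqrt (n%:RR * k%:RR / b%:RR))).
Proof.
(* The square 40000 of 200 exceeds both products of constants, 48 * 576 = 27648 and 18 * 2 = 36. The
   bandwidth is written q + 1. *)
exists 200; split=> // n [//|q] k b q0 qn _ b0 _.
have P0 : 0 < q.+1%:R :> RR by rewrite ltr0n.
have B0 : 0 < b%:R :> RR by rewrite ltr0n.
have k0 : 0 <= k%:R :> RR by rewrite ler0n.
have n0 : 0 <= n%:R :> RR by rewrite ler0n.
have sqrt_le (c x : RR) : 0 <= x -> c <= 200 ^+ 2 -> Num.sqrt (c * x) <= 200 * Num.sqrt x.
  move=> x0 c_le; have -> : 200 = Num.sqrt (200 ^+ 2) :> RR by rewrite sqrtr_sqr ger0_norm.
  by rewrite -sqrtrM ?sqr_ge0 // ler_wsqrtr // ler_wpM2r.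
split=> [g g0 g1|].
- have [dl gE] : exists dl, g = 1 - dl by exists (1 - g); ring.
  subst g; have dl0 : 0 < dl by lra.
  have dl1 : dl < 1 by lra.
  have -> : `|1 - dl - 2^-1| = `|dl - 2^-1| by rewrite -normrN; congr `|_|; lra.
  move=> dlP {g0 g1}.
  have [L_ge _] := near_half_bounds _ _ _ q0 dlP.
  have frob_le := near_half_frob_le _ _ _ n%:R dl0 dl1 q0 n0 dlP.
  have sens_le := near_half_sens_le _ _ _ b%:R dl0 dl1 q0 B0 dlP.
  apply: le_trans (rmse_le _ _ k _ _ _ _ dl0 dl1 qn b0 frob_le sens_le) _.
  move: {sens_le frob_le dlP} (k%:R) (b%:R) (n%:R) (q.+1%:R) (ln q.+1%:R)
    L_ge P0 n0 B0 k0 => k' B N P L L_ge P0 N0 B0 k0.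
  have L0 : 0 <= L by lra.
  (* The product expands into exactly the squares of the four target terms. *)
  have -> : 48 * (L + N / P) * (k' * (576 * (L + P / B))) = 48 * 576 *
      (k' * L ^+ 2 + N * k' / B + N * k' * L / P + k' * P * L / B).
    by field; rewrite !gt_eqF.
  have a0 : 0 <= k' * L ^+ 2 by rewrite mulr_ge0 ?sqr_ge0.
  have b0' : 0 <= N * k' / B by rewrite divr_ge0 ?mulr_ge0 ?(ltW B0).
  have c0 : 0 <= N * k' * L / P by rewrite divr_ge0 ?mulr_ge0 ?(ltW P0).
  have d0 : 0 <= k' * P * L / B by rewrite divr_ge0 ?mulr_ge0 ?(ltW P0) ?(ltW B0).
  apply: le_trans (sqrt_le _ _ _ _) _; [by rewrite !addr_ge0 | lra |].
  rewrite ler_pM2l //.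
  have -> : Num.sqrt k' * L = Num.sqrt (k' * L ^+ 2).
    by rewrite sqrtrM // sqrtr_sqr ger0_norm.
  apply: le_trans (sqrtrD_le _ _ _ _ _) _; rewrite ?addr_ge0 // lerD2r.
  apply: le_trans (sqrtrD_le _ _ _ _ _) _; rewrite ?addr_ge0 // lerD2r.
  exact: sqrtrD_le.
move=> p_le; cbv zeta; set r := Num.sqrt n%:R in p_le *; set dl := q.+1%:R / r.
have r0 : 0 < r by lra.
have nE : n%:R = r ^+ 2 :> RR by rewrite sqr_sqrtr.
have dl0 : 0 < dl by rewrite divr_gt0.
have dl4 : dl <= 4^-1 by rewrite ler_pdivrMr // mulrC.
have dl1 : dl < 1 by lra.
have dlr : dl * r = q.+1%:R by rewrite divfK ?gt_eqF.
have frob_le := near_one_frob_le _ _ _ _ dl0 dl4 q0 r0 dlr.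
have sens_le := near_one_sens_le _ _ _ _ b%:R dl0 dl4 q0 r0 B0 dlr.
rewrite -nE in frob_le.
apply: le_trans (rmse_le _ _ k _ _ _ _ dl0 dl1 qn b0 frob_le sens_le) _.
have W0 : 0 < q.+1%:R `^ dl by rewrite powR_gt0.
rewrite nE; move: (k%:R) (b%:R) (q.+1%:R `^ dl) k0 B0 W0 => k' B W k0 B0 W0.
(* The powers W^2 cancel, leaving the squares of the two target terms because r = sqrt n. *)
have -> : 18 * W ^+ 2 * (k' * (2 * (r + r ^+ 2 / B) / W ^+ 2)) =
    36 * (k' * r + r ^+ 2 * k' / B) by field; rewrite !gt_eqF.
have a0 : 0 <= k' * r by rewrite mulr_ge0 // ltW.
have c0 : 0 <= r ^+ 2 * k' / B by rewrite divr_ge0 ?mulr_ge0 ?sqr_ge0 // ltW.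
apply: le_trans (sqrt_le _ _ _ _) _; [by rewrite addr_ge0 | lra |].
by rewrite ler_pM2l // -sqrtrM //; exact: sqrtrD_le.
Qed.
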